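(* Let $p,q\in[1,\infty)$ and $\alpha_0:=n\left(\frac1q-\frac1p\right)$. (i) If $\alpha_0\in(0,\infty)$, then $JNQ^{\alpha_0}_{p,q}(\mathbb{R}^n)\supset W^{\alpha_0,q}(\mathbb{R}^n)$ and $\|\cdot\|_{JNQ^{\alpha_0}_{p,q}(\mathbb{R}^n)}\le\|\cdot\|_{W^{\alpha_0,q}(\mathbb{R}^n)}$. (ii) If $\alpha_0=0$, then $JNQ^{\alpha_0}_{p,q}(\mathbb{R}^n)=W^{\alpha_0,q}(\mathbb{R}^n)=\{0\}$.
   Context: Here $n\in\mathbb{N}$, $n\ge1$. A measurable function $f$ on $\mathbb{R}^n$ is a Lebesgue measurable function with $|f|<\infty$ almost everywhere. A cube has finite positive edge length and all its edges parallel to the coordinate axes, and need not be open or closed. For $\ell\in(0,\infty)$, $\Pi_\ell$ is the class of all collections $\{Q_j\}_j$ of cubes of $\mathbb{R}^n$ with pairwise disjoint interiors and equal edge length $\ell$. For $p,q\in[1,\infty)$ and $\alpha\in\mathbb{R}$, $JNQ^{\alpha}_{p,q}(\mathbb{R}^n)$ is the set of all measurable $f$ on $\mathbb{R}^n$ with $$\|f\|_{JNQ^\alpha_{p,q}(\mathbb{R}^n)}:=\sup_{\ell\in(0,\infty),\,\{Q_j\}_j\in\Pi_\ell}\Big\{\sum_j|Q_j|\Big[|Q_j|^{\frac{q\alpha}{n}-1}\int_{Q_j}\int_{Q_j}\frac{|f(x)-f(y)|^q}{|x-y|^{n+q\alpha}}\,dy\,dx\Big]^{p/q}\Big\}^{1/p}<\infty.$$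 For $s\in\mathbb{R}$ and $q\in[1,\infty)$, $W^{s,q}(\mathbb{R}^n)$ is the set of all measurable $f$ on $\mathbb{R}^n$ with $$\|f\|_{W^{s,q}(\mathbb{R}^n)}:=\Big[\int_{\mathbb{R}^n}\int_{\mathbb{R}^n}\frac{|f(x)-f(y)|^q}{|x-y|^{n+sq}}\,dx\,dy\Big]^{1/q}<\infty.$$ $\{0\}$ denotes the set of functions that are constant almost everywhere. *)

(* Defs.v *)
From HB Require Import structures.
From mathcomp Require Import all_boot all_order all_algebra.
From mathcomp Require Import all_classical all_reals all_analysis.
From mathcomp Require Import measurable_realfun.

Set Implicit Arguments.
Unset Strict Implicit.
Unset Printing Implicit Defensive.

Import Order.TTheory GRing.Theory Num.Theory.
Import numFieldNormedType.Exports.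

Local Open Scope classical_set_scope.
Local Open Scope ring_scope.

Section LebesgueMeasure.
Variable R : realType.

Definition cons_pair (n : nat)
    (x : n.-tuple (measurableTypeR R) * measurableTypeR R) :
    n.+1.-tuple (measurableTypeR R) :=
  [the n.+1.-tuple (measurableTypeR R) of x.2 :: x.1].

Lemma measurable_cons_pair (n : nat) : measurable_fun setT (@cons_pair n).
Proof. exact: measurable_cons. Qed.

Section product_step.
Variables (n : nat).
Variable mu : {measure set (n.-tuple (measurableTypeR R)) -> \bar R}.

Definition product_step : set (n.+1.-tuple (measurableTypeR R)) -> \bar R :=
  pushforward (mu \x lebesgue_measure)%E (@cons_pair n).

Let product_step0 : product_step set0 = 0%E.
Proof. by rewrite /product_step /pushforward preimage_set0 measure0. Qed.

Let product_step_ge0 A : (0 <= product_step A)%E.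
Proof. by rewrite /product_step /pushforward measure_ge0. Qed.

Let product_step_sigma_additive : semi_sigma_additive product_step.
Proof.
move=> F mF tF mUF.
have mp := @measurable_cons_pair n.
rewrite /product_step /pushforward preimage_bigcup.
apply: measure_semi_sigma_additive.
- by move=> k; rewrite -[X in measurable X]setTI; exact: mp.
- apply/trivIsetP => /= i j _ _ ij; rewrite -preimage_setI.
  by move/trivIsetP : tF => /(_ _ _ _ _ ij) ->//; rewrite preimage_set0.
- by rewrite -preimage_bigcup -[X in measurable X]setTI; exact: mp.
Qed.

HB.instance Definition _ := isMeasure.Build _ _ _ product_step
  product_step0 product_step_ge0 product_step_sigma_additive.

End product_step.

(* n-fold product of the one-dimensional Lebesgue measure, on the Borel
   (= product) sigma-algebra; the one-point space of dimension 0 has mass 1. *)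
Fixpoint product_lebesgue (n : nat) :
    {measure set (n.-tuple (measurableTypeR R)) -> \bar R} :=
  match n return {measure set (n.-tuple (measurableTypeR R)) -> \bar R} with
  | 0 => \d_([tuple] : 0.-tuple (measurableTypeR R))
  | m.+1 => product_step (product_lebesgue m)
  end.

(* R^n with the sigma-algebra of Lebesgue measurable sets, i.e. the
   Caratheodory sets of the outer measure induced by product_lebesgue. *)
Definition Rn (n : nat) : Type :=
  caratheodory_type ((product_lebesgue n)^*)%mu.
HB.instance Definition _ (n : nat) := Measurable.on (Rn n).

Definition lebesgue_Rn (n : nat) : set (Rn n) -> \bar R :=
  @completed_measure_extension _ _ _ (product_lebesgue n).
HB.instance Definition _ (n : nat) := Measure.on (@lebesgue_Rn n).

End LebesgueMeasure.
Arguments lebesgue_Rn {R n}.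

Section Spaces.
Variables (R : realType) (n : nat).
Local Notation mu := (@lebesgue_Rn R n).

Definition coord (x : Rn R n) (i : 'I_n) : R := tnth (x : n.-tuple R) i.

Definition row_of (x : Rn R n) : 'rV[R]_n := \row_i coord x i.

Definition euclid_dist (x y : Rn R n) : R :=
  Num.sqrt (\sum_(i < n) (coord x i - coord y i) ^+ 2).

Definition lebesgue_measurable (f : Rn R n -> \bar R) : Prop :=
  measurable_fun setT f /\ {ae mu, forall x, f x \is a fin_num}.

(* Each edge is an interval from a_i to a_i + l containing either, both or none
   of its endpoints, as recorded by b i and c i. *)
Definition is_cube (l : R) (Q : set (Rn R n)) : Prop :=
  0 < l /\
  exists (a : 'I_n -> R) (b c : 'I_n -> bool),
    Q = [set x | forall i, coord x i \in
                   Interval (BSide (b i) (a i)) (BSide (c i) (a i + l))].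

(* Interiors are taken in the topology of 'rV[R]_n. *)
Definition Pi_class (l : R) : set (set (set (Rn R n))) :=
  [set C | (forall Q, C Q -> is_cube l Q) /\
           (forall Q1 Q2, C Q1 -> C Q2 -> Q1 <> Q2 ->
              (row_of @` Q1)° `&` (row_of @` Q2)° = set0)].

Local Open Scope ereal_scope.

(* On the (null) diagonal the value is a convention of ereal division. *)
Definition diff_kernel (q e : R) (f : Rn R n -> \bar R) (x y : Rn R n) :
    \bar R :=
  `|f x - f y| `^ q / (euclid_dist x y `^ e)%:E.

Definition JNQ_sum (p q alpha : R) (f : Rn R n -> \bar R)
    (C : set (set (Rn R n))) : \bar R :=
  \esum_(Q in C)
    (mu Q *
     (mu Q `^ (q * alpha / n%:R - 1) *
      \int[mu]_(x in Q) \int[mu]_(y in Q)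
        diff_kernel q (n%:R + q * alpha) f x y) `^ (p / q)).

Definition JNQ_norm (p q alpha : R) (f : Rn R n -> \bar R) : \bar R :=
  ereal_sup [set JNQ_sum p q alpha f C `^ p^-1 |
             C in \bigcup_(l in [set l : R | (0 < l)%R]) Pi_class l].

Definition JNQ (p q alpha : R) : set (Rn R n -> \bar R) :=
  [set f | lebesgue_measurable f /\ JNQ_norm p q alpha f < +oo].

Definition W_norm (s q : R) (f : Rn R n -> \bar R) : \bar R :=
  (\int[mu]_y \int[mu]_x diff_kernel q (n%:R + s * q) f x y) `^ q^-1.

Definition W (s q : R) : set (Rn R n -> \bar R) :=
  [set f | lebesgue_measurable f /\ W_norm s q f < +oo].

(* Such an f is automatically Lebesgue measurable, by completeness of mu. *)
Definition ae_constants : set (Rn R n -> \bar R) :=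
  [set f | exists c : R, {ae mu, forall x, f x = c%:E}].

End Spaces.

(* Main.v *)
From HB Require Import structures.
Require Import Defs.
From mathcomp Require Import all_boot all_order all_algebra.
From mathcomp Require Import all_classical all_reals all_analysis.
From mathcomp Require Import measurable_realfun lra ring.

Set Implicit Arguments.
Unset Strict Implicit.
Unset Printing Implicit Defensive.

Import Order.TTheory GRing.Theory Num.Theory.
Import numFieldNormedType.Exports.

Local Open Scope classical_set_scope.
Local Open Scope ring_scope.

(** Write K(x, y) for the kernel |f(x) - f(y)|^q / |x - y|^(n + q alpha0) and
    E(A, B) for its double integral over A x B.  The choice of alpha0 makes
    |Q|^(q alpha0 / n - 1) = |Q|^(-q/p), so that in every term of the JNQ sum
    the powers of |Q| cancel and only E(Q, Q)^(p/q) is left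
    ([JNQ_term_cube]).

    For alpha0 >= 0 we have p/q >= 1, hence a sum of (p/q)-th powers is at most
    the (p/q)-th power of the sum.  Cubes with disjoint interiors may be replaced
    by disjoint open cubes, since faces are null sets, and the sum of E over
    disjoint diagonal blocks is at most E over the whole space; this gives
    [JNQ_norm_le_W_norm].

    For alpha0 = 0 it remains to see that a function of finite JNQ norm is
    constant almost everywhere, the other inclusions being immediate.  Testing
    the norm on a single cube bounds E(Q, Q) by a constant M which does not
    depend on Q ([cube_energy_le_JNQ_norm]).  Fix the cube A = ]-N, N[^n and
    consider the disjoint cubes B_k = ]2^k N, 2^(k+1) N[^n.  Comparing f(x) and
    f(y), for x and y in A, through f(z) with z ranging over B_k, bounds the
    double integral of |f(x) - f(y)|^q over A x A by a constant times that of
    |f(x) - f(z)|^q over A x B_k divided by |B_k|.  The distance of x and z is at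
    most a multiple of the edge 2^k N, so 1/|B_k| = (2^k N)^(-n) is at most a
    constant times 1/|x - z|^n, and the bound is C E(A, B_k) with C independent
    of k
    ([oscillation_le_remote]).  Summing over k < m gives
    m * (oscillation over A) <= C M for every m, so that the oscillation
    vanishes ([central_oscillation_eq0]).  As the cubes A exhaust the space, f
    is constant almost everywhere ([ae_constant_of_no_oscillation]). *)

(** * Powers of nonnegative extended reals *)

Section ereal_powers.
Context {R : realType}.
Local Open Scope ereal_scope.
Implicit Types (x y : \bar R) (r : R).

Lemma ge0_le_poweR x y r : (0 <= r)%R -> 0 <= x -> x <= y -> x `^ r <= y `^ r.
Proof.
move=> r0 x0 xy; apply: gt0_ler_poweR => //; rewrite in_itv/= leey andbT//.
exact: le_trans xy.
Qed.

(** From t^r = t * t^(r-1) and the monotonicity of t^(r-1). *)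
Lemma poweR_superadditive x y r : (1 <= r)%R -> 0 <= x -> 0 <= y ->
  x `^ r + y `^ r <= (x + y) `^ r.
Proof.
move=> r1 x0 y0; have r0 : (0 <= r)%R by rewrite (le_trans _ r1).
have rn0 : r != 0%R by rewrite gt_eqF// (lt_le_trans _ r1).
case: x x0 => [x||]//= x0; last first.
  by rewrite addye ?poweRyr ?leey//; case: y y0.
case: y y0 => [y||]//= y0; last by rewrite (negbTE rn0) leey.
rewrite -?EFinD lee_fin.
rewrite !lee_fin in x0 y0.
have xy0 : (0 <= x + y)%R by exact: addr_ge0.
have rgt0 : (0 < r)%R by rewrite (lt_le_trans _ r1).
rewrite -[(x `^ r)%R]mulr_powRB1// -[(y `^ r)%R]mulr_powRB1//.
rewrite -[((x + y) `^ r)%R]mulr_powRB1// mulrDl.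
by apply: lerD; apply: ler_wpM2l => //; apply: ge0_ler_powR;
  rewrite ?subr_ge0 ?nnegrE// ?lerDl ?lerDr.
Qed.

Lemma poweR_sum_superadditive (I : Type) (s : seq I) (F : I -> \bar R) r :
  (1 <= r)%R -> (forall i, 0 <= F i) ->
  \sum_(i <- s) F i `^ r <= (\sum_(i <- s) F i) `^ r.
Proof.
move=> r1 F0; elim: s => [|i s ih]; first by rewrite !big_nil poweR_ge0.
rewrite !big_cons (le_trans _ (poweR_superadditive _ _ _))//.
- exact: leeD.
- exact: sume_ge0.
Qed.

(** A crude constant is enough here: x + y is at most twice the larger term. *)
Lemma poweRD_le x y r : (0 <= r)%R -> 0 <= x -> 0 <= y ->
  (x + y) `^ r <= (2 `^ r)%:E * (x `^ r + y `^ r).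
Proof.
move=> r0.
wlog : x y / x <= y.
  move=> H x0 y0; have [xy|yx] := leP x y; first exact: H.
  by rewrite addeC (addeC (_ `^ _)) H// ltW.
move=> xy x0 y0.
rewrite -poweR_EFin.
have xy2y : x + y <= (2%:R)%:E * y by rewrite mule_natl mule2n leeD2r.
apply: (@le_trans _ _ (((2%:R)%:E * y) `^ r)).
  by apply: ge0_le_poweR => //; exact: adde_ge0.
rewrite poweRM//; apply: lee_wpmul2l; first exact: poweR_ge0.
by rewrite leeDr// poweR_ge0.
Qed.

End ereal_powers.

(** * Lebesgue measure of boxes *)

Section box_measure.
Context {R : realType}.

Definition tuple_box n (I : 'I_n -> interval R) :
    set (n.-tuple (measurableTypeR R)) :=
  [set t | forall i, tnth t i \in I i].

Lemma measurable_tuple_box n (I : 'I_n -> interval R) :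
  measurable (tuple_box I).
Proof.
have -> : tuple_box I =
    \bigcap_(i in [set: 'I_n]) ((fun t => tnth t i) @^-1` [set` I i]).
  by apply/seteqP; split => t /= h i; [move=> _|]; exact: h.
apply: fin_bigcap_measurable => // i _.
by rewrite -[X in measurable X]setTI; apply: measurable_tnth => //;
  exact: measurable_itv.
Qed.

Lemma product_lebesgue_box n (I : 'I_n -> interval R) :
  product_lebesgue R n (tuple_box I) =
  (\prod_(i < n) lebesgue_measure [set` I i])%E.
Proof.
elim: n I => [|n ih] I.
  by rewrite big_ord0 /= diracE mem_set// => -[].
rewrite big_ord_recl /= /product_step /pushforward.
have -> : cons_pair (n:=n) @^-1` tuple_box I =
    tuple_box (fun i => I (lift ord0 i)) `*` [set` I ord0].
  apply/seteqP; split => [[t x] /= h|[t x] /= [ht hx] i].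
    split => [i|]; last by have := h ord0.
    by have := h (lift ord0 i); rewrite tnthS.
  by case: (unliftP ord0 i) => [j|] -> //; rewrite tnthS; exact: ht.
rewrite product_measure1E; [|exact: measurable_tuple_box|exact: measurable_itv].
by rewrite ih muleC.
Qed.

Lemma product_lebesgue_sigma_finite n :
  sigma_finite setT (product_lebesgue R n).
Proof.
exists (fun k : nat => tuple_box (fun _ : 'I_n => `[- k%:R, k%:R])).
  apply/seteqP; split => // t _.
  pose k := (\max_(i < n) (Num.truncn `|tnth t i|).+1)%N.
  exists k => // i; rewrite in_itv/= -ler_norml.
  rewrite (le_trans (ltW (truncnS_gt _)))// ler_nat.
  exact: (leq_bigmax (F := fun i : 'I_n => (Num.truncn `|tnth t i|).+1)).
move=> k; split; first exact: measurable_tuple_box.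
rewrite product_lebesgue_box ltey_eq; apply/orP; left.
elim/big_ind: _ => //=; first by move=> x y; exact: fin_numM.
by move=> i _; rewrite lebesgue_measure_itv /=; case: ifP.
Qed.

End box_measure.

(** Registers sigma-finiteness of Lebesgue measure on the completed
    sigma-algebra, as required by the Tonelli theorem. *)
HB.instance Definition _ (R : realType) (n : nat) :=
  Measure_isSigmaFinite.Build _ _ _ (@lebesgue_Rn R n)
   (completed_measure_extension_sigma_finite (@product_lebesgue_sigma_finite R n)).

(** * Cubes and their interiors *)

Section cubes.
Context {R : realType} {n : nat}.
Local Notation mu := (@lebesgue_Rn R n).
Local Notation coord := (@Defs.coord R n).

Lemma measurable_coord (i : 'I_n) :
  measurable_fun setT (fun x : Rn R n => coord x i : measurableTypeR R).
Proof.
move=> _ Y mY; apply: caratheodory_measurable_mu_ext.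
exact: measurable_tnth.
Qed.

Definition cube (b c : 'I_n -> bool) (a : 'I_n -> R) (l : R) :
    set (Rn R n) :=
  [set x | forall i, coord x i \in
     Interval (BSide (b i) (a i)) (BSide (c i) (a i + l))].

Lemma measurable_cube b c a l : measurable (cube b c a l).
Proof.
apply: caratheodory_measurable_mu_ext.
exact: (measurable_tuple_box
  (fun i => Interval (BSide (b i) (a i)) (BSide (c i) (a i + l)))).
Qed.

Lemma lebesgue_cube b c a (l : R) : 0 < l -> mu (cube b c a l) = (l ^+ n)%:E.
Proof.
move=> l0.
rewrite /lebesgue_Rn /completed_measure_extension.
rewrite (measurable_mu_extE (product_lebesgue R n)); last first.
  exact: (measurable_tuple_box
    (fun i => Interval (BSide (b i) (a i)) (BSide (c i) (a i + l)))).
rewrite (product_lebesgue_box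
  (fun i => Interval (BSide (b i) (a i)) (BSide (c i) (a i + l)))).
under eq_bigr => i _.
  rewrite lebesgue_measure_itv /= lte_fin ltrDl l0 -EFinB [a i + l]addrC addrK.
  over.
by rewrite prodEFin prodr_const card_ord.
Qed.

Local Notation open_cube := (cube (fun=> false) (fun=> true)).

Lemma open_cube_sub b c a l : open_cube a l `<=` cube b c a l.
Proof.
move=> x ox i; have := ox i; rewrite in_itv/= => /andP[? ?].
by rewrite in_itv/=; case: (b i); case: (c i) => /=; apply/andP; split => //;
  exact: ltW.
Qed.

(** The faces form a null set because a cube and its open version have the same
    measure. *)
Lemma cubeD_open_cube_null b c a l : 0 < l ->
  mu (cube b c a l `\` open_cube a l) = 0%E.
Proof.
move=> l0; transitivity (mu (cube b c a l) - mu (open_cube a l))%E; last first.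
  by rewrite !lebesgue_cube// subee.
rewrite -[X in (_ - mu X)%E](setIidr (@open_cube_sub b c a l)).
apply: measureD; [exact: measurable_cube..|].
by move: (lebesgue_cube b c a l0) => /= ->; rewrite ltry.
Qed.

(** Half of the description of the interior; it suffices to turn disjointness
    of interiors into disjointness of open cubes. *)
Lemma open_cube_interior b c a l :
  @row_of R n @` open_cube a l `<=` (@row_of R n @` cube b c a l)°.
Proof.
move=> _ [x ox <-].
exists (fun _ i => `]a i, (a i + l)[%classic) => [i j|M /= oM].
  by rewrite mxE; apply: near_in_itvoo; exact: ox.
exists [tuple M ord0 i | i < n]; last first.
  by apply/rowP => i; rewrite mxE /coord tnth_mktuple.
apply: open_cube_sub => i; rewrite /coord tnth_mktuple.
exact: oM.
Qed.

End cubes.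

Notation open_cube := (cube (fun=> false) (fun=> true)).

(** * Double integrals of nonnegative functions *)

Section double_integrals.
Context d (T : measurableType d) (R : realType).
Variable mu : {sigma_finite_measure set T -> \bar R}.
Local Open Scope ereal_scope.
Implicit Types (g h : T -> T -> \bar R) (A B : set T).

Definition double_integral g A B :=
  \int[mu]_(x in A) \int[mu]_(y in B) g x y.

Definition jointly_measurable g :=
  measurable_fun setT (fun xy : T * T => g xy.1 xy.2).

Lemma jointly_measurable_section g x B :
  jointly_measurable g -> measurable_fun B (g x).
Proof.
move=> mg; apply: measurable_funTS.
exact: (measurableT_comp mg (pair1_measurable x)).
Qed.

(** Tonelli measurability, applied to the integrand cut off outside of B. *)
Lemma measurable_partial_integral g B : jointly_measurable g ->
  (forall x y, 0 <= g x y) -> measurable B ->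
  measurable_fun setT (fun x => \int[mu]_(y in B) g x y).
Proof.
move=> mg g0 mB.
pose h (xy : T * T) := g xy.1 xy.2 * (\1_B xy.2)%:E.
have -> : (fun x => \int[mu]_(y in B) g x y) = fubini_F mu h.
  apply/funext => x; rewrite /fubini_F [LHS]integral_mkcond.
  by apply: eq_integral => y _; rewrite epatch_indic.
apply: measurable_fun_fubini_tonelli_F.
  apply: emeasurable_funM => //; apply/measurable_EFinP.
  exact: (measurableT_comp (measurable_indic mB) measurable_snd).
by move=> xy; rewrite mule_ge0// lee_fin.
Qed.

Section fixed_integrand.
Variable g : T -> T -> \bar R.
Hypotheses (mg : jointly_measurable g) (g0 : forall x y, 0 <= g x y).

Let mgB B D : measurable B ->
  measurable_fun D (fun x => \int[mu]_(y in B) g x y).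
Proof. by move=> mB; apply/measurable_funTS/measurable_partial_integral. Qed.

Let gB0 B x : 0 <= \int[mu]_(y in B) g x y.
Proof. exact: integral_ge0. Qed.

Lemma double_integral_ge0 A B : 0 <= double_integral g A B.
Proof. exact: integral_ge0. Qed.

Lemma double_integral_subset A A' B B' :
  measurable A -> measurable A' -> measurable B -> measurable B' ->
  A `<=` A' -> B `<=` B' ->
  double_integral g A B <= double_integral g A' B'.
Proof.
move=> mA mA' mB mB' AA' BB'.
apply: (@le_trans _ _ (double_integral g A B')).
  apply: ge0_le_integral => //; [exact: mgB|exact: mgB|move=> x _].
  by apply: ge0_subset_integral => //; exact: jointly_measurable_section.
by apply: ge0_subset_integral => //; exact: mgB.
Qed.

Lemma double_integral_null A A' : measurable A -> measurable A' ->
  A' `<=` A -> mu (A `\` A') = 0 ->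
  double_integral g A A = double_integral g A' A'.
Proof.
move=> mA mA' A'A null.
have mAA' : measurable (A `\` A') by exact: measurableD.
have AAA' : A `\` (A `\` A') = A' by rewrite setDD setIidr.
rewrite /double_integral (ge0_negligible_integral mAA') ?AAA'//; last exact: mgB.
apply: eq_integral => x _.
rewrite (ge0_negligible_integral mAA') ?AAA'//.
exact: jointly_measurable_section.
Qed.

Lemma double_integral_sumr (I : eqType) (s : seq I) (F : I -> set T) A :
  (forall i, measurable (F i)) -> uniq s -> trivIset [set` s] F ->
  measurable A ->
  \sum_(i <- s) double_integral g A (F i) =
  double_integral g A (\big[setU/set0]_(i <- s) F i).
Proof.
move=> mF us tF mA.
rewrite -ge0_integral_sum//; last by move=> i; exact: mgB.
apply: eq_integral => x _; rewrite ge0_integral_bigsetU//.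
exact: jointly_measurable_section.
Qed.

(** Each diagonal block F i x F i lies in the strip F i x T, and the strips are
    disjoint. *)
Lemma double_integral_sum_diag (I : eqType) (s : seq I) (F : I -> set T) :
  (forall i, measurable (F i)) -> uniq s -> trivIset [set` s] F ->
  \sum_(i <- s) double_integral g (F i) (F i) <= double_integral g setT setT.
Proof.
move=> mF us tF.
apply: (@le_trans _ _ (\sum_(i <- s) double_integral g (F i) setT)).
  by apply: lee_sum => i _; apply: double_integral_subset.
rewrite /double_integral -ge0_integral_bigsetU//; last exact: mgB.
apply: ge0_subset_integral => //; last exact: mgB.
exact: bigsetU_measurable.
Qed.

Lemma double_integral_eq0 A : measurable A -> double_integral g A A = 0 ->
  {ae mu, forall x, A x -> {ae mu, forall y, A y -> g x y = 0}}.
Proof.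
move=> mA gA0.
have : ae_eq mu A (fun x => \int[mu]_(y in A) g x y) (cst 0).
  apply/(ae_eq_integral_abs mu mA); first exact: mgB.
  by rewrite -[RHS]gA0; apply: eq_integral => x _; rewrite gee0_abs.
apply: filterS => x /= hx /hx {}hx.
have : ae_eq mu A (g x) (cst 0); last exact.
apply/(ae_eq_integral_abs mu mA); first exact: jointly_measurable_section.
by rewrite -[RHS]hx; apply: eq_integral => y _; rewrite gee0_abs.
Qed.

Lemma double_integral_ae0 (P : T -> Prop) A B : measurable A -> measurable B ->
  {ae mu, forall x, P x} -> (forall x y, P x -> P y -> g x y = 0) ->
  double_integral g A B = 0.
Proof.
move=> mA mB aeP gP.
transitivity (\int[mu]_(x in A) cst 0 x); last exact: integral0.
apply: ae_eq_integral => //; first exact: mgB.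
apply: (filterS _ aeP) => x Px _ /=.
transitivity (\int[mu]_(y in B) cst 0 y); last exact: integral0.
apply: ae_eq_integral => //; first exact: jointly_measurable_section.
by apply: (filterS _ aeP) => y Py _ /=; exact: gP.
Qed.

(** Integrate the quasi-triangle inequality for g over x and y in A and z in B:
    each of the two terms on the right is independent of one of the variables in
    A, which contributes the factor mu A.  By the symmetry of g both terms are
    integrals of the partial integral G below, so that the order of integration
    never has to be changed. *)
Lemma double_integral_quasi_triangle (c : R) A B :
  (0 <= c)%R -> (forall x y, g x y = g y x) ->
  (forall x y z, g x y <= c%:E * (g x z + g z y)) ->
  measurable A -> measurable B ->
  double_integral g A A * mu B <=
  c%:E * (double_integral g A B * mu A + double_integral g A B * mu A).
Proof.
move=> c0 gC tri mA mB.
pose G x := \int[mu]_(z in B) g x z.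
have mG D : measurable_fun D G by exact: mgB.
have G0 x : 0 <= G x by exact: gB0.
have gG x y : g x y * mu B <= c%:E * (G x + G y).
  rewrite -integral_cst// -ge0_integralD//; [|exact: jointly_measurable_section..].
  rewrite -ge0_integralZl//.
  - apply: ge0_le_integral => //=.
    + apply: emeasurable_funM => //; apply: emeasurable_funD;
        exact: jointly_measurable_section.
    + by move=> z _; rewrite (gC y z).
  - by apply: emeasurable_funD; exact: jointly_measurable_section.
  - by move=> z _; rewrite adde_ge0.
have mGy x D : measurable_fun D (fun y => G x + G y).
  by apply: emeasurable_funD.
rewrite /double_integral -ge0_integralZr//; last exact: mgB.
apply: (@le_trans _ _
    (\int[mu]_(x in A) (c%:E * (G x * mu A + \int[mu]_(y in A) G y)))).
  apply: ge0_le_integral => //.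
  - by move=> x _; rewrite mule_ge0.
  - by apply: emeasurable_funM => //; exact: mgB.
  - apply: emeasurable_funM => //; apply: emeasurable_funD => //.
    exact: emeasurable_funM.
  - move=> x _; rewrite -ge0_integralZr//; last exact: jointly_measurable_section.
    rewrite -integral_cst// -ge0_integralD//; last by move=> y _; exact: G0.
    rewrite -ge0_integralZl//.
    + apply: ge0_le_integral => //.
      * by move=> y _; rewrite mule_ge0.
      * by apply: emeasurable_funM => //; exact: jointly_measurable_section.
      * by apply: emeasurable_funM => //; exact: mGy.
    + exact: mGy.
    + by move=> y _; apply: adde_ge0; exact: G0.
have Gint0 : 0 <= \int[mu]_(y in A) G y by exact: integral_ge0.
rewrite ge0_integralZl//; last 2 first.
- by apply: emeasurable_funD => //; exact: emeasurable_funM.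
- by move=> x _; rewrite adde_ge0// mule_ge0.
rewrite lee_wpmul2l ?lee_fin//.
rewrite ge0_integralD//; last 2 first.
- by move=> x _; rewrite mule_ge0.
- exact: emeasurable_funM.
by rewrite ge0_integralZr// integral_cst.
Qed.

End fixed_integrand.

Lemma double_integral_le g h A B : jointly_measurable g ->
  jointly_measurable h -> (forall x y, 0 <= g x y) -> (forall x y, 0 <= h x y) ->
  measurable A -> measurable B ->
  (forall x y, A x -> B y -> g x y <= h x y) ->
  double_integral g A B <= double_integral h A B.
Proof.
move=> mg mh g0 h0 mA mB gh; apply: ge0_le_integral => //.
- by move=> x _; exact: integral_ge0.
- exact/measurable_funTS/measurable_partial_integral.
- exact/measurable_funTS/measurable_partial_integral.
- move=> x Ax; apply: ge0_le_integral => //; [exact: jointly_measurable_section..|].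
  by move=> y By; exact: gh.
Qed.

Lemma double_integralZl g (k : R) A B : jointly_measurable g ->
  (forall x y, 0 <= g x y) -> (0 <= k)%R -> measurable A -> measurable B ->
  double_integral (fun x y => k%:E * g x y) A B = k%:E * double_integral g A B.
Proof.
move=> mg g0 k0 mA mB; rewrite /double_integral -ge0_integralZl ?lee_fin//.
- apply: eq_integral => x _; rewrite ge0_integralZl ?lee_fin//.
  exact: jointly_measurable_section.
- exact/measurable_funTS/measurable_partial_integral.
- by move=> x _; exact: integral_ge0.
Qed.

End double_integrals.

(** * The difference kernel *)

Section difference_kernel.
Context {R : realType} {n : nat}.
Local Notation mu := (@lebesgue_Rn R n).
Local Open Scope ereal_scope.
Implicit Types (f : Rn R n -> \bar R) (q e : R).

(** The numerator of the difference kernel. *)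
Definition oscillation q f (x y : Rn R n) := `|f x - f y| `^ q.

Lemma oscillation_ge0 q f x y : 0 <= oscillation q f x y.
Proof. exact: poweR_ge0. Qed.

Lemma abse_subC (x y : \bar R) : `|x - y| = `|y - x|.
Proof. by case: x => [x||]; case: y => [y||] //=; rewrite distrC. Qed.

Lemma oscillationC q f x y : oscillation q f x y = oscillation q f y x.
Proof. by rewrite /oscillation abse_subC. Qed.

Lemma jointly_measurable_oscillation q f : measurable_fun setT f ->
  jointly_measurable (oscillation q f).
Proof.
move=> mf; apply: (measurableT_comp (measurable_poweR q)).
apply: (measurableT_comp (@abse_measurable R setT)).
apply: emeasurable_funB; first exact: (measurableT_comp mf measurable_fst).
exact: (measurableT_comp mf measurable_snd).
Qed.

Lemma euclid_distC (x y : Rn R n) : euclid_dist x y = euclid_dist y x.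
Proof.
by congr Num.sqrt; apply: eq_bigr => i _; rewrite -sqrrN opprB.
Qed.

Lemma measurable_euclid_dist :
  measurable_fun setT (fun xy : Rn R n * Rn R n => euclid_dist xy.1 xy.2).
Proof.
rewrite (_ : (fun _ => _) = (@powR R ^~ (2^-1)%R) \o
   (fun xy : Rn R n * Rn R n =>
      \sum_(i < n) (Defs.coord xy.1 i - Defs.coord xy.2 i) ^+ 2)%R); last first.
  apply/funext => xy /=; rewrite powR12_sqrt// sumr_ge0// => i _.
  exact: sqr_ge0.
apply: measurableT_comp; first exact: measurable_powR.
apply: measurable_sum => i; apply: measurable_funX; apply: measurable_funB.
  exact: (measurableT_comp (measurable_coord i) measurable_fst).
exact: (measurableT_comp (measurable_coord i) measurable_snd).
Qed.

Lemma diff_kernelE q e f x y :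
  diff_kernel q e f x y = oscillation q f x y / (euclid_dist x y `^ e)%:E.
Proof. by []. Qed.

Lemma inve_powR_ge0 (d e : R) : 0 <= (d `^ e)%:E^-1.
Proof.
by rewrite inver; case: ifP => // _; rewrite lee_fin invr_ge0 powR_ge0.
Qed.

Lemma diff_kernel_ge0 q e f x y : 0 <= diff_kernel q e f x y.
Proof. by rewrite mule_ge0 ?poweR_ge0 ?inve_powR_ge0. Qed.

Lemma diff_kernelC q e f x y : diff_kernel q e f x y = diff_kernel q e f y x.
Proof. by rewrite !diff_kernelE oscillationC euclid_distC. Qed.

Lemma jointly_measurable_diff_kernel q e f : measurable_fun setT f ->
  jointly_measurable (diff_kernel q e f).
Proof.
move=> mf; apply: emeasurable_funM.
  exact: jointly_measurable_oscillation.
pose den (xy : Rn R n * Rn R n) : R := (euclid_dist xy.1 xy.2 `^ e)%R.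
have mden : measurable_fun setT den.
  apply: (measurableT_comp (measurable_powR e)).
  exact: measurable_euclid_dist.
(* The inverse is +oo where the denominator vanishes, and a power with exponent
   -1 elsewhere. *)
rewrite (_ : (fun _ => _) =
    (fun xy => if den xy == 0%R then +oo else (den xy `^ (-1))%R%:E)); last first.
  apply/funext => xy; rewrite inver; case: ifP => // _.
  by rewrite powR_inv1// powR_ge0.
apply: measurable_fun_ifT => //; first exact: measurable_fun_eqr.
apply/measurable_EFinP; apply: (measurableT_comp (measurable_powR _)) => //.
Qed.

Lemma W_normE s q f : W_norm s q f =
  double_integral mu (diff_kernel q (n%:R + s * q) f) setT setT `^ q^-1.
Proof.
rewrite /W_norm; move: (diff_kernelC q (n%:R + s * q) f).
move: (diff_kernel _ _ _) => K KC.
have KE : (fun y x => K x y) = K.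
  by apply/funext => y; apply/funext => x; exact: KC.
by rewrite -[in RHS]KE.
Qed.

End difference_kernel.

(** * Comparison of the two norms *)

Section JNQ_versus_W.
Context {R : realType} {n : nat}.
Local Notation mu := (@lebesgue_Rn R n).
Variables p q : R.
Hypotheses (n0 : (0 < n)%N) (p1 : 1 <= p) (q1 : 1 <= q).
Local Notation alpha := (n%:R * (q^-1 - p^-1))%R.
Local Open Scope ereal_scope.
Implicit Types (f : Rn R n -> \bar R) (Q : set (Rn R n)).

Let p0 : (0 < p)%R. Proof. exact: lt_le_trans p1. Qed.
Let q0 : (0 < q)%R. Proof. exact: lt_le_trans q1. Qed.

(** With |Q| = l^n the exponent q alpha / n - 1 is -q/p; raising to the power p/q
    produces |Q|^-1, which cancels the leading factor |Q|. *)
Lemma JNQ_term_cube f Q b c a (l : R) : measurable_fun setT f ->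
  (0 < l)%R -> Q = cube b c a l ->
  mu Q * (mu Q `^ (q * alpha / n%:R - 1) *
    \int[mu]_(x in Q) \int[mu]_(y in Q)
      diff_kernel q (n%:R + q * alpha) f x y) `^ (p / q) =
  double_integral mu (diff_kernel q (n%:R + q * alpha) f)
    (open_cube a l) (open_cube a l) `^ (p / q).
Proof.
move=> mf l0 QE.
have K0 : forall x y, 0 <= diff_kernel q (n%:R + q * alpha) f x y.
  exact: diff_kernel_ge0.
have mK : jointly_measurable (diff_kernel q (n%:R + q * alpha) f).
  exact: jointly_measurable_diff_kernel.
rewrite -(@double_integral_null _ _ _ mu _ mK K0 Q); last first.
- by rewrite QE; exact: cubeD_open_cube_null.
- by rewrite QE; exact: open_cube_sub.
- exact: measurable_cube.
- by rewrite QE; exact: measurable_cube.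
have -> : mu Q = (l ^+ n)%:E by rewrite QE; exact: lebesgue_cube.
have := double_integral_ge0 mu K0 Q Q.
rewrite /double_integral.
move: (integral _ _ _) => I I0.
have nR0 : n%:R != 0%R :> R by rewrite pnatr_eq0 -lt0n.
have -> : (q * alpha / n%:R - 1 = - (q / p))%R.
  by field; rewrite nR0 !gt_eqF.
have ln0 : (0 < l ^+ n)%R by exact: exprn_gt0.
rewrite poweRM ?poweR_ge0// -poweRrM !poweR_EFin.
have -> : (- (q / p) * (p / q) = -1)%R by field; rewrite !gt_eqF.
by rewrite powR_inv1 ?(ltW ln0)// muleA -EFinM divff ?mul1e// gt_eqF.
Qed.

(** The corner function is defined on all sets, with a junk value outside of C,
    so that the open cubes form a family of measurable sets indexed by a type. *)
Lemma Pi_class_open_cubes l (C : set (set (Rn R n))) : Pi_class l C ->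
  exists a : set (Rn R n) -> ('I_n -> R),
    (forall Q, C Q -> exists b c, Q = cube b c (a Q) l) /\
    trivIset C (fun Q => open_cube (a Q) l).
Proof.
move=> [cubeC disjC].
have /choice[a aE] : forall Q, exists a, C Q -> exists b c, Q = cube b c a l.
  move=> Q; have [CQ|nCQ] := pselect (C Q); last by exists (fun=> 0%R) => /nCQ.
  have [_ [a [b [c QE]]]] := cubeC _ CQ.
  by exists a => _; exists b, c.
exists a; split => // Q1 Q2 CQ1 CQ2 [x [x1 x2]].
apply: contrapT => Q12.
have : set0 (@row_of R n x).
  rewrite -(disjC _ _ CQ1 CQ2 Q12); split.
    have [b [c ->]] := aE _ CQ1.
    by apply: open_cube_interior; exists x.
  have [b [c ->]] := aE _ CQ2.
  by apply: open_cube_interior; exists x.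
by [].
Qed.

Lemma JNQ_sum_ge0 f C : 0 <= JNQ_sum p q alpha f C.
Proof.
apply: esum_ge0 => Q _; apply: mule_ge0; last exact: poweR_ge0.
exact: measure_ge0.
Qed.

Lemma JNQ_norm_le_W_norm f : (0 <= alpha)%R -> lebesgue_measurable f ->
  JNQ_norm p q alpha f <= W_norm alpha q f.
Proof.
move=> alpha0 [mf _].
rewrite W_normE [(alpha * q)%R]mulrC.
have K0 : forall x y, 0 <= diff_kernel q (n%:R + q * alpha) f x y.
  exact: diff_kernel_ge0.
have mK : jointly_measurable (diff_kernel q (n%:R + q * alpha) f).
  exact: jointly_measurable_diff_kernel.
have pq1 : (1 <= p / q)%R.
  rewrite ler_pdivlMr// mul1r.
  rewrite pmulr_rge0 ?ltr0n// subr_ge0 in alpha0.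
  by rewrite -lef_pV2// posrE.
apply: ge_ereal_sup => _ [C [l /= l0 CPi] <-].
suff sumle : JNQ_sum p q alpha f C <=
    double_integral mu (diff_kernel q (n%:R + q * alpha) f) setT setT `^ (p / q).
  move: sumle (JNQ_sum_ge0 f C).
  move: (JNQ_sum _ _ _ _ _) (double_integral _ _ _ _) => S I SI S0.
  have -> : (q^-1 = p / q * p^-1)%R by field; rewrite !gt_eqF.
  by rewrite [leRHS]poweRrM; apply: ge0_le_poweR => //; rewrite invr_ge0 ltW.
have [a [aE tC]] := Pi_class_open_cubes CPi.
apply: ge_ereal_sup => _ [D [finD DC] <-].
rewrite fsbig_finite//.
apply: (@le_trans _ _ (\sum_(Q <- finmap.enum_fset (fset_set D))
    double_integral mu (diff_kernel q (n%:R + q * alpha) f)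
      (open_cube (a Q) l) (open_cube (a Q) l) `^ (p / q))).
  rewrite big_seq [leRHS]big_seq; apply: lee_sum => Q.
  rewrite in_fset_set// inE => /DC CQ.
  have [b [c QE]] := aE _ CQ.
  by rewrite (JNQ_term_cube mf l0 QE).
apply: (le_trans (poweR_sum_superadditive _ pq1 _)).
  by move=> Q; exact: double_integral_ge0.
apply: ge0_le_poweR.
- by rewrite (le_trans _ pq1).
- by apply: sume_ge0 => Q _; exact: double_integral_ge0.
apply: double_integral_sum_diag => //.
- by move=> Q; exact: measurable_cube.
- move=> Q1 Q2 /=; rewrite !in_fset_set// !inE => /DC ? /DC ?; exact: tC.
Qed.

(** The collection consisting of a single cube is a competitor in the
    supremum. *)
Lemma cube_energy_le_JNQ_norm f a (l : R) : measurable_fun setT f ->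
  (0 < l)%R ->
  double_integral mu (diff_kernel q (n%:R + q * alpha) f)
    (open_cube a l) (open_cube a l) <= JNQ_norm p q alpha f `^ q.
Proof.
move=> mf l0.
suff powle : double_integral mu (diff_kernel q (n%:R + q * alpha) f)
    (open_cube a l) (open_cube a l) `^ q^-1 <= JNQ_norm p q alpha f.
  move: (double_integral_ge0 mu (diff_kernel_ge0 q (n%:R + q * alpha) f)
    (open_cube a l) (open_cube a l)) powle.
  move: (double_integral _ _ _ _) (JNQ_norm _ _ _ _) => I N I0 IN.
  rewrite -[leLHS](poweRe1 I0) -(mulVf (x := q)) ?gt_eqF// poweRrM.
  by apply: ge0_le_poweR => //; [exact: ltW|exact: poweR_ge0].
have JNQ_sum1 : JNQ_sum p q alpha f [set (open_cube a l : set (Rn R n))] =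
    double_integral mu (diff_kernel q (n%:R + q * alpha) f)
      (open_cube a l) (open_cube a l) `^ (p / q).
  rewrite -(@JNQ_term_cube f (open_cube a l) (fun=> false) (fun=> true) a l)//.
  apply: esum_set1; apply: mule_ge0; [exact: measure_ge0|exact: poweR_ge0].
have : JNQ_sum p q alpha f [set (open_cube a l : set (Rn R n))] `^ p^-1 <=
    JNQ_norm p q alpha f.
  apply: ereal_sup_ubound; exists [set (open_cube a l : set (Rn R n))] => //.
  exists l => //; split => [Q ->|Q1 Q2 -> -> //].
  by split => //; exists a, (fun=> false), (fun=> true).
rewrite JNQ_sum1; move: (double_integral _ _ _ _) (JNQ_norm _ _ _ _) => I N.
by rewrite -poweRrM (_ : p / q * p^-1 = q^-1)%R//; field; rewrite !gt_eqF.
Qed.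

End JNQ_versus_W.

(** * Rigidity in the critical case *)

Section rigidity.
Context {R : realType} {n : nat}.
Local Notation mu := (@lebesgue_Rn R n).
Local Open Scope ereal_scope.
Implicit Types (f : Rn R n -> \bar R).

(** It survives infinite values because the difference of two equal infinities is
    infinite here. *)
Lemma abse_sub_triangle (x y z : \bar R) : `|x - y| <= `|x - z| + `|z - y|.
Proof.
case: x => [x||]; case: y => [y||]; case: z => [z||] //=; rewrite ?leey//.
by rewrite -EFinD lee_fin; exact: ler_distD.
Qed.

Lemma oscillation_quasi_triangle q f x y z : (0 <= q)%R ->
  oscillation q f x y <=
  (2 `^ q)%:E * (oscillation q f x z + oscillation q f z y).
Proof.
move=> q0; apply: (le_trans _ (poweRD_le q0 _ _)) => //.
by apply: ge0_le_poweR => //; exact: abse_sub_triangle.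
Qed.

(** Also valid where the denominator of the kernel vanishes: there the kernel is
    +oo unless the oscillation is zero. *)
Lemma oscillation_le_diff_kernel q e f x y (D : R) :
  (0 <= e)%R -> (0 < D)%R -> (euclid_dist x y <= D)%R ->
  oscillation q f x y <= (D `^ e)%:E * diff_kernel q e f x y.
Proof.
move=> e0 D0 xyD; rewrite diff_kernelE.
have d0 : (0 <= euclid_dist x y)%R by exact: sqrtr_ge0.
have := oscillation_ge0 q f x y.
move: (oscillation q f x y) (euclid_dist x y) xyD d0 => o d dD d0 o0.
have De0 : (0 < D `^ e)%R by exact: powR_gt0.
rewrite inver; case: ifPn => [_|de0].
  move: o0; rewrite le_eqVlt => /predU1P[<-|o0]; first by rewrite mul0e mule0.
  by rewrite gt0_muley// gt0_muley ?lte_fin// leey.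
rewrite muleCA -EFinM -[leLHS]mule1; apply: lee_wpmul2l => //.
rewrite lee_fin ler_pdivlMr ?mul1r; last by rewrite lt_def de0 powR_ge0.
by apply: ge0_ler_powR => //; rewrite nnegrE ltW.
Qed.

Definition central_cube (N : R) : set (Rn R n) :=
  open_cube (fun=> (- N)%R) (N + N)%R.
(** For edges l = 2^k N these cubes are disjoint, and points of a central cube of
    half-edge at most l are within a fixed multiple of l of them. *)
Definition remote_cube (l : R) : set (Rn R n) := open_cube (fun=> l) l.

Lemma central_remote_dist (N l : R) x z : (0 < N)%R -> (N <= l)%R ->
  central_cube N x -> remote_cube l z ->
  (euclid_dist x z <= 3 * Num.sqrt n%:R * l)%R.
Proof.
move=> N0 Nl Ax Bz; have l0 : (0 < l)%R by exact: lt_le_trans Nl.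
have -> : (3 * Num.sqrt n%:R * l = Num.sqrt (\sum_(i < n) (3 * l) ^+ 2))%R.
  rewrite sumr_const card_ord -[X in _ = Num.sqrt X]mulr_natl.
  rewrite [in RHS]sqrtrM ?ler0n// sqrtr_sqr ger0_norm.
    by rewrite mulrCA mulrA.
  by rewrite mulr_ge0// ltW.
rewrite ler_wsqrtr//; apply: ler_sum => i _.
have := Ax i; have := Bz i; rewrite !in_itv/= => /andP[? ?] /andP[? ?].
rewrite -subr_ge0 subr_sqr mulr_ge0//; lra.
Qed.

(** The key scaling step: averaging over the remote cube divides by its measure
    l^n, while passing from the oscillation to the kernel of exponent n costs
    (c l)^n with c = 3 sqrt n.  The constant is therefore independent of l. *)
Lemma oscillation_le_remote q f (N l : R) :
  (0 <= q)%R -> measurable_fun setT f -> (0 < n)%N -> (0 < N)%R -> (N <= l)%R ->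
  double_integral mu (oscillation q f) (central_cube N) (central_cube N) <=
  (2 `^ q * (N + N) ^+ n * 2 * (3 * Num.sqrt n%:R) ^+ n)%:E *
  double_integral mu (diff_kernel q n%:R f) (central_cube N) (remote_cube l).
Proof.
move=> q0 mf n0 N0 Nl; have l0 : (0 < l)%R by exact: lt_le_trans Nl.
set c : R := (3 * Num.sqrt n%:R)%R.
have c0 : (0 < c)%R by rewrite mulr_gt0// sqrtr_gt0 ltr0n.
have ln0 : (0 < l ^+ n)%R by exact: exprn_gt0.
have mO := jointly_measurable_oscillation q mf.
have mK := jointly_measurable_diff_kernel q n%:R mf.
have mA : measurable (central_cube N) by exact: measurable_cube.
have mB : measurable (remote_cube l) by exact: measurable_cube.
have muA : mu (central_cube N) = ((N + N) ^+ n)%:E.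
  by apply: lebesgue_cube; rewrite addr_gt0.
have muB : mu (remote_cube l) = (l ^+ n)%:E by exact: lebesgue_cube.
have main :
    double_integral mu (oscillation q f) (central_cube N) (central_cube N) *
    (l ^+ n)%:E <= (2 `^ q)%:E *
    (double_integral mu (oscillation q f) (central_cube N) (remote_cube l) *
       ((N + N) ^+ n)%:E +
     double_integral mu (oscillation q f) (central_cube N) (remote_cube l) *
       ((N + N) ^+ n)%:E).
  rewrite -muA -muB; apply: double_integral_quasi_triangle => //.
  - exact: oscillation_ge0.
  - exact: oscillationC.
  - by move=> x y z; exact: oscillation_quasi_triangle.
have remote_bound : double_integral mu (oscillation q f) (central_cube N) (remote_cube l) <=
    ((c * l) ^+ n)%:E *
    double_integral mu (diff_kernel q n%:R f) (central_cube N) (remote_cube l).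
  have cl0 : (0 < c * l)%R by rewrite mulr_gt0.
  rewrite -double_integralZl//; last 2 first.
  - exact: diff_kernel_ge0.
  - by rewrite exprn_ge0// ltW.
  apply: double_integral_le => //.
  - by apply: emeasurable_funM.
  - exact: oscillation_ge0.
  - move=> x y; apply: mule_ge0; last exact: diff_kernel_ge0.
    by rewrite lee_fin exprn_ge0// ltW.
  - move=> x z Ax Bz; rewrite -powR_mulrn ?(ltW cl0)//.
    by apply: oscillation_le_diff_kernel => //; exact: central_remote_dist Ax Bz.
have K0 := double_integral_ge0 mu (diff_kernel_ge0 q n%:R f) (central_cube N) (remote_cube l).
have O0 := double_integral_ge0 mu (oscillation_ge0 q f) (central_cube N) (remote_cube l).
move: main remote_bound K0 O0.
move: (double_integral _ _ _ _) => I.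
move: (double_integral _ _ _ _) => EO.
move: (double_integral _ _ _ _) => EK main remote_bound K0 O0.
rewrite -(@lee_pmul2r _ (l ^+ n)%:E)// ?lte_fin//.
apply: (le_trans main).
have N2n : (0 <= (N + N) ^+ n)%R by rewrite exprn_ge0// addr_ge0// ltW.
rewrite -ge0_muleDr ?lee_fin// -EFinD muleCA -EFinM muleC.
apply: (@le_trans _ _ ((2 `^ q * ((N + N) ^+ n + (N + N) ^+ n))%:E *
    (((c * l) ^+ n)%:E * EK))).
  by apply: lee_wpmul2l => //; rewrite lee_fin mulr_ge0 ?powR_ge0 ?addr_ge0.
rewrite muleA -EFinM [leRHS]muleAC -EFinM.
by rewrite le_eqVlt; apply/orP; left; apply/eqP; congr (_%:E * _); rewrite exprMn; ring.
Qed.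


(** The blocks central_cube N x remote_cube (2^k N), k < m, are disjoint and lie
    in one common cube, so their energies sum up to at most M; yet each of them
    is at least a fixed multiple of the central oscillation. *)
Lemma central_oscillation_eq0 q f (N M : R) :
  (0 <= q)%R -> measurable_fun setT f -> (0 < n)%N -> (0 < N)%R ->
  (forall a l, (0 < l)%R -> double_integral mu (diff_kernel q n%:R f)
     (open_cube a l) (open_cube a l) <= M%:E) ->
  double_integral mu (oscillation q f) (central_cube N) (central_cube N) = 0.
Proof.
move=> q0 mf n0 N0 bounded.
set C : R := (2 `^ q * (N + N) ^+ n * 2 * (3 * Num.sqrt n%:R) ^+ n)%R.
have C0 : (0 <= C)%R.
  by rewrite !mulr_ge0 ?powR_ge0 ?exprn_ge0 ?addr_ge0 ?(ltW N0)// mulr_ge0.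
pose B (k : nat) : set (Rn R n) := remote_cube (2 ^+ k * N)%R.
have mA : measurable (central_cube N) by exact: measurable_cube.
have mB k : measurable (B k) by exact: measurable_cube.
have mK := jointly_measurable_diff_kernel q n%:R mf.
have tB : trivIset setT B.
  suff lt_disj i j (x : Rn R n) : (i < j)%N -> B i x -> B j x -> False.
    move=> i j _ _ [x [Bi Bj]].
    by case: (ltngtP i j) => // ij; exfalso; exact: (lt_disj _ _ _ ij).
  move=> ij Bi Bj.
  have := Bi (Ordinal n0); have := Bj (Ordinal n0).
  rewrite !in_itv/= => /andP[lj _] /andP[_ ui].
  have : (2 ^+ i.+1 * N <= 2 ^+ j * N)%R.
    by rewrite ler_pM2r// ler_weXn2l// ler1n.
  rewrite exprS; lra.
have bound m : m%:R%:E *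
    double_integral mu (oscillation q f) (central_cube N) (central_cube N) <= (C * M)%:E.
  (* The cube ]-N, 2^m N[^n contains the central cube and the first m remote
     cubes. *)
  pose Q : set (Rn R n) := open_cube (fun=> (- N)%R) ((2 ^+ m + 1) * N)%R.
  apply: (@le_trans _ _ (\sum_(0 <= k < m) (C%:E *
      double_integral mu (diff_kernel q n%:R f) (central_cube N) (B k)))).
    have -> : m%:R%:E = \sum_(0 <= k < m) 1%:E :> \bar R.
      by rewrite sumEFin sumr_const_nat subn0.
    rewrite ge0_sume_distrl => [|k _]; last by rewrite lee_fin.
    apply: lee_sum => k _; rewrite mul1e; apply: oscillation_le_remote => //.
    by rewrite -[leLHS]mul1r ler_pM2r// exprn_ege1// ler1n.
  rewrite -ge0_sume_distrr; last first.
    by move=> k _; apply: double_integral_ge0; exact: diff_kernel_ge0.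
  rewrite [in leRHS]EFinM; apply: lee_wpmul2l; first by rewrite lee_fin.
  rewrite double_integral_sumr//; last 3 first.
  - exact: diff_kernel_ge0.
  - exact: iota_uniq.
  - exact: sub_trivIset tB.
  have mN : (0 < (2 ^+ m + 1) * N)%R by rewrite mulr_gt0// addr_gt0.
  apply: le_trans (bounded (fun=> (- N)%R) _ mN).
  apply: double_integral_subset => //.
  - exact: diff_kernel_ge0.
  - exact: measurable_cube.
  - exact: bigsetU_measurable.
  - exact: measurable_cube.
  - move=> x Ax i; have := Ax i; rewrite !in_itv/= => /andP[-> h]/=.
    apply: (lt_le_trans h); rewrite lerD2l.
    have : (1 <= 2 ^+ m :> R)%R by rewrite exprn_ege1// ler1n.
    move=> m1; rewrite mulrDl mul1r lerD2r -[leLHS]mul1r ler_pM2r//.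
  - rewrite big_seq; apply: (big_ind (fun S => S `<=` Q)) => //.
      by move=> S S' SQ S'Q; rewrite subUset.
    move=> k; rewrite mem_index_iota/= => km x Bx i.
    have := Bx i; rewrite !in_itv/= => /andP[lx ux].
    have : (2 ^+ k.+1 * N <= 2 ^+ m * N)%R.
      by rewrite ler_pM2r// ler_weXn2l// ler1n.
    have : (0 < 2 ^+ k * N)%R by rewrite mulr_gt0// exprn_gt0.
    rewrite exprS => ? ?; apply/andP; split; lra.
have := double_integral_ge0 mu (oscillation_ge0 q f) (central_cube N) (central_cube N).
move: (double_integral _ _ _ _) bound => I bound.
case: I bound => [r||] bound //; last by have := bound 1%N; rewrite mul1e.
rewrite lee_fin le_eqVlt => /predU1P[<-//|r0].
have := bound (Num.truncn (C * M / r)).+1; rewrite -EFinM lee_fin.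
rewrite -ler_pdivlMr// leNgt => /negP[].
exact: truncnS_gt.
Qed.

Lemma central_exhausts (x : Rn R n) : exists k0 : nat, forall k : nat,
  (k0 <= k)%N -> central_cube k.+1%:R x.
Proof.
pose k0 := (\max_(i < n) (Num.truncn `|Defs.coord x i|).+1)%N.
exists k0 => k k0k i; rewrite in_itv/= addKr -ltr_norml.
apply: (lt_le_trans (truncnS_gt _)); rewrite ler_nat.
apply: (leq_trans _ (leqW k0k)).
exact: (leq_bigmax (F := fun i : 'I_n => (Num.truncn `|Defs.coord x i|).+1)).
Qed.

Lemma lebesgue_Rn_gt0 : 0 < mu setT.
Proof.
apply: (@lt_le_trans _ _ (mu (central_cube 1))).
  by rewrite lebesgue_cube ?lte_fin ?exprn_gt0 ?addr_gt0.
by apply: le_measure => //; rewrite inE; [exact: measurable_cube|exact: measurableT].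
Qed.

(** As the double integrals vanish, almost every x agrees with almost every y in
    each central cube around x.  Countably many cubes exhaust the space, so one
    such x at which f is finite provides the constant. *)
Lemma ae_constant_of_no_oscillation q f :
  (0 < q)%R -> lebesgue_measurable f ->
  (forall N : R, (0 < N)%R ->
     double_integral mu (oscillation q f) (central_cube N) (central_cube N) = 0) ->
  ae_constants f.
Proof.
move=> q0 [mf f_fin] osc0.
have mO := jointly_measurable_oscillation q mf.
have osc_ae : {ae mu, forall x, forall k : nat, central_cube k.+1%:R x ->
    {ae mu, forall y, central_cube k.+1%:R y -> oscillation q f x y = 0}}.
  apply: ae_foralln => k.
  apply: double_integral_eq0 => //; first exact: oscillation_ge0.
    exact: measurable_cube.
  by apply: osc0; rewrite ltr0n.
have := @filter_ex _ _ (ae_properfilter_algebraOfSetsType lebesgue_Rn_gt0) _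
  (filterI f_fin osc_ae).
move=> [x [/fineK fx oscx]].
(* Only cubes large enough to contain x carry information, whence the shift by
   kx. *)
exists (fine (f x)); rewrite fx.
have [kx xk] := central_exhausts x.
have : {ae mu, forall y, forall k : nat,
    central_cube (kx + k).+1%:R y -> oscillation q f x y = 0}.
  by apply: ae_foralln => k; apply: oscx; apply: xk; exact: leq_addr.
apply: filterS => y oscy.
have [ky yk] := central_exhausts y.
have : oscillation q f x y = 0 by apply: (oscy ky); apply: yk; exact: leq_addl.
move=> /poweR_eq0_eq0 -/(_ (abse_ge0 _)) /eqP; rewrite abse_eq0 -fx.
by case: (f y) => [r||]//=; rewrite -EFinB eqe subr_eq0 => /eqP ->.
Qed.

(** Measurability rests on the completeness of Lebesgue measure; the kernel is
    zero at pairs where f takes the constant value, even on the diagonal, since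
    0 * +oo = 0. *)
Lemma ae_constant_W s q f : (0 < q)%R -> ae_constants f ->
  lebesgue_measurable f /\ W_norm s q f = 0.
Proof.
move=> q0 [c fc].
have mf : measurable_fun setT f.
  apply: (@ae_measurable_fun _ _ _ mu _ setT (cst c%:E)) => //.
    exact: measure_is_complete_caratheodory.
  by apply: filterS fc => x ->.
split; first by split => //; apply: filterS fc => x ->.
rewrite W_normE; set K := diff_kernel _ _ _.
have K0 : forall x y, 0 <= K x y by exact: diff_kernel_ge0.
have mK : jointly_measurable K by exact: jointly_measurable_diff_kernel.
suff -> : double_integral mu K setT setT = 0.
  by rewrite poweR0r// invr_eq0 gt_eqF.
apply: (double_integral_ae0 mK K0 measurableT measurableT fc) => x y fxc fyc.
rewrite /K diff_kernelE /oscillation fxc fyc.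
by rewrite -EFinB subrr abse0 poweR0r ?gt_eqF// mul0e.
Qed.

End rigidity.

Lemma JNQ_sub_ae_constants (R : realType) (n : nat) (p q : R) :
  (0 < n)%N -> 1 <= p -> 1 <= q -> n%:R * (q^-1 - p^-1) = 0 ->
  @JNQ R n p q (n%:R * (q^-1 - p^-1)) `<=` @ae_constants R n.
Proof.
move=> n0 p1 q1 alpha0 f [[mf f_fin] JNQfin].
have q0 : 0 < q by exact: lt_le_trans q1.
have JNQq_fin : (JNQ_norm p q (n%:R * (q^-1 - p^-1)) f `^ q)%E \is a fin_num.
  by rewrite ge0_fin_numE ?poweR_ge0// poweR_lty.
apply: (ae_constant_of_no_oscillation q0 (conj mf f_fin)) => N N0.
apply: (central_oscillation_eq0
  (M := fine (JNQ_norm p q (n%:R * (q^-1 - p^-1)) f `^ q)%E)) => //.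
  exact: ltW.
move=> a l l0; rewrite fineK//.
have := cube_energy_le_JNQ_norm n0 p1 q1 a mf l0.
by rewrite alpha0 mulr0 addr0.
Qed.

Theorem proposition2p15 (R : realType) (n : nat) (hn : (0 < n)%N)
    (p q : R) (hp : 1 <= p) (hq : 1 <= q) :
  let alpha0 : R := n%:R * (q^-1 - p^-1) in
  (0 < alpha0 ->
     @W R n alpha0 q `<=` @JNQ R n p q alpha0 /\
     (forall f : Rn R n -> \bar R, lebesgue_measurable f ->
        (JNQ_norm p q alpha0 f <= W_norm alpha0 q f)%E)) /\
  (alpha0 = 0 ->
     @JNQ R n p q alpha0 = @W R n alpha0 q /\
     @W R n alpha0 q = @ae_constants R n).
Proof.
move=> alpha0.
have W_JNQ : 0 <= alpha0 -> @W R n alpha0 q `<=` @JNQ R n p q alpha0.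
  move=> alpha_ge0 f [mf Wf]; split => //; apply: le_lt_trans Wf.
  exact: JNQ_norm_le_W_norm.
split => [alpha_gt0|alpha_eq0].
  split; first exact/W_JNQ/ltW.
  by move=> f mf; apply: JNQ_norm_le_W_norm => //; exact: ltW.
have q0 : 0 < q by exact: lt_le_trans hq.
have const_W : @ae_constants R n `<=` @W R n alpha0 q.
  move=> f /(ae_constant_W alpha0 q0)[mf Wf0].
  by split => //; rewrite Wf0 ltry.
have JNQ_const : @JNQ R n p q alpha0 `<=` @ae_constants R n.
  exact: JNQ_sub_ae_constants.
have WJ : @W R n alpha0 q `<=` @JNQ R n p q alpha0 by apply: W_JNQ; rewrite alpha_eq0.
split; apply/seteqP; split.
- exact: subset_trans JNQ_const const_W.
- exact: WJ.
- exact: subset_trans WJ JNQ_const.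
- exact: const_W.
Qed.
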